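(* The second barycentric subdivision $\mathrm{sd}^2(K)$ of any collapsible finite simplicial complex $K$ carries Morse shellings using one closed simplex as unique critical tile.
   Context: Simplices and complexes. An $n$-simplex is a set of $n+1$ vertices; its faces are all its subsets, including the empty set (of dimension $-1$). A finite simplicial complex $K$ is a collection of subsets of a finite vertex set containing all singletons and closed under taking subsets (so it contains $\emptyset$). Facets are maximal simplices; a ridge of a simplex is a codimension one face. A relative simplex is a simplex deprived of several proper faces (together with all the faces of those). A relative simplicial complex is $S=K\setminus L$, with $L$ a (possibly empty) subcomplex of $K$ containing no facet of $K$; $|S|=|K|\setminus|L|$. A relative subcomplex of $S$ is $K'\setminus L$ with $K'$ a subcomplex of $K$. $\mathrm{sd}^2$ denotes the second barycentric subdivision. Collapsibility. A subcomplex $K'$ of $K$ is an elementary collapse of $K$ if $K\setminus K'$ consists of a facet of $K$ together with one of its ridges not contained in any other facet of $K$. $K$ is collapsible if it can be reduced to a single vertex by a finite sequence of elementary collapses. Tiles. A basic tile of dimension $n$ and order $k\in\{0,\dots,n+1\}$ is an $n$-simplex deprived of $k$ ridges. A Morse tile of dimension $n$ and order $k$ is an $n$-simplex deprived of $k$ ridges and possibly also of a unique face of codimension at least $2$ (its Morse face; the empty face is allowed). For a basic tile $T$ of order $k$, the restriction set $r(T)$ is the face, of dimension $k-1$, whose vertices are those opposite to the $k$ missing ridges. The critical tiles of dimension $n$ are: the closed simplex (index $0$), and the tiles $T\setminus r(T)$, for $T$ a basic tile of dimension $n$ and order $k\in\{0,\dots,n\}$ (index $k$). For $k=0$ the latter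 is the closed simplex deprived of its empty face, and for $k=n$ it is the open simplex (only the top face). Morse tiles which are not critical are called regular. Shellings. A relative facet of $S=K\setminus L$ is a relative simplex of the form $\sigma\setminus\tau$, where $\sigma$ is a facet of $K$ and $\tau$ is a subcomplex of $\sigma$ containing $\sigma\cap L$. A tiling of $S$ is a partition of its geometric realization by relative facets. A shelling of the tiling is a filtration $\emptyset=S_0\subset S_1\subset\dots\subset S_N=S$ by relative subcomplexes such that for every $p\in\{1,\dots,N\}$, $S_p\setminus S_{p-1}$ consists of a single relative facet of the tiling. A Morse shelling is a shelling of a tiling all of whose relative facets are Morse tiles; its critical tiles are the tiles of the tiling which are critical. *)

(* Defs.v *)
From mathcomp Require Import all_boot all_order all_algebra.
From mathcomp Require Import reals.
From mathcomp Require classical_sets.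

Set Implicit Arguments.
Unset Strict Implicit.
Unset Printing Implicit Defensive.

Import GRing.Theory Num.Theory.

(* A simplex is a finite set of vertices (dimension = cardinal - 1), and
   complexes, subcomplexes, relative complexes and relative simplices are all
   represented by the sets of their faces, the empty face being a genuine
   element. *)

Section Complexes.
Variable V : finType.
Implicit Types (s t r m : {set V}) (K L F : {set {set V}}).

Definition face_closed K := [forall s in K, powerset s \subset K].

(* The vertex set of K is the set of v : V such that [set v] \in K; it need not
   be the whole of V. *)
Definition simplicial_complex K := (set0 \in K) && face_closed K.

(* A subcomplex may be empty, i.e. need not even contain the empty face. *)
Definition subcomplex L K := (L \subset K) && face_closed L.

Definition facet K s := maxset [in K] s.

Definition ridge r s := (r \subset s) && (#|s| == #|r|.+1).

Definition elementary_collapse K K' :=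
  subcomplex K' K &&
  [exists s, exists r,
    [&& K :\: K' == [set s; r], facet K s, ridge r s
      & [forall t, facet K t && (r \subset t) ==> (t == s)]]].

(* powerset [set v] is the complex with the single vertex v. *)
Definition collapsible K :=
  [exists v, connect elementary_collapse K (powerset [set v])].

(* Barycentric subdivision: the vertices are the nonempty simplices of K, the
   simplices are the sets of vertices that are totally ordered by inclusion. *)
Definition sd K : {set {set {set V}}} :=
  [set c : {set {set V}} |
    [&& c \subset K, set0 \notin c
      & [forall s in c, forall t in c, (s \subset t) || (t \subset s)]]].

(* The simplex s deprived of the faces in F and of all the faces of those. *)
Definition deprive s F : {set {set V}} :=
  [set t in powerset s | [forall f in F, ~~ (t \subset f)]].

(* S = K :\: L *)
Definition relative_complex K L :=
  [&& simplicial_complex K, subcomplex L K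
    & [forall s, facet K s ==> (s \notin L)]].

(* A :\: L for a subcomplex A of K *)
Definition relative_subcomplex K L (S' : {set {set V}}) :=
  exists2 A, subcomplex A K & S' = A :\: L.

(* s :\: t for a facet s of K and a subcomplex t of s containing s :&: L; t
   consists of proper faces of s. *)
Definition relative_facet K L (T : {set {set V}}) :=
  exists s, exists t : {set {set V}},
    [/\ facet K s, subcomplex t (powerset s), s \notin t,
        powerset s :&: L \subset t & T = powerset s :\: t].

End Complexes.

Section Tiles.
Variable V : finType.
Implicit Types (s m : {set V}) (F T : {set {set V}}).

(* s is an n-simplex and F a set of k of its ridges. *)
Definition missing_ridges n k s F :=
  [&& #|s| == n.+1, #|F| == k & [forall r in F, ridge r s]].

Definition basic_tile n k T :=
  exists s F, missing_ridges n k s F /\ T = deprive s F.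

(* m is the Morse face; its codimension in s is #|s| - #|m|. *)
Definition morse_tile n k T :=
  basic_tile n k T \/
  exists s F m, [/\ missing_ridges n k s F, m \subset s, #|m| + 2 <= #|s|
                  & T = deprive s (m |: F)].

(* The vertices of s opposite to the ridges in F: the restriction set of the
   basic tile deprive s F. *)
Definition restriction_set s F : {set V} := [set v in s | s :\ v \in F].

Definition closed_simplex n T := exists2 s : {set V}, #|s| = n.+1 & T = powerset s.

(* A critical tile of dimension n and index k. *)
Definition critical_tile n k T :=
  (k = 0 /\ closed_simplex n T) \/
  (k <= n /\ exists s F, missing_ridges n k s F /\
                         T = deprive s (restriction_set s F |: F)).

End Tiles.

Section Shellings.
Variables (R : realType) (V : finType).
Implicit Types (K L A : {set {set V}}) (tiles : {set {set {set V}}}).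

(* In barycentric coordinates: the union of the relative interiors of the
   simplices in A. For a complex K this is |K|, and for K :\: L it is
   |K| \ |L|. *)
Definition realization A : classical_sets.set (V -> R) :=
  fun x => [/\ forall v, (0 <= x v)%R, (\sum_v x v = 1)%R
             & [set v | x v != 0%R] \in A].

Lemma realizationD K L :
  realization (K :\: L) = classical_sets.setD (realization K) (realization L).
Proof.
apply/classical_sets.seteqP; split=> x.
  case=> x0 x1; rewrite inE => /andP[xL xK]; split; first by split.
  by case=> _ _ xL'; rewrite xL' in xL.
case=> [[x0 x1 xK] xL]; split=> //; rewrite inE xK andbT.
by apply/negP => xL'; apply: xL; split.
Qed.

Definition tiling K L tiles :=
  [/\ relative_complex K L,
      forall T, T \in tiles -> relative_facet K L T
    & classical_sets.partition (fun T => T \in tiles : Prop) realization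
        (realization (K :\: L))].

Definition shelling K L tiles N (S : nat -> {set {set V}}) :=
  [/\ S 0 = set0, S N = K :\: L,
      forall p, p <= N -> relative_subcomplex K L (S p)
    & forall p, p < N -> S p \subset S p.+1 /\ S p.+1 :\: S p \in tiles].

Definition morse_shelling K L tiles N S :=
  [/\ tiling K L tiles, shelling K L tiles N S
    & forall T, T \in tiles -> exists n k, morse_tile n k T].

End Shellings.

(* Main.v *)
(* Call a flag complex M nonevasive when its vertices can be added one by one,
   each along a nonevasive link.  If K is collapsible then sd K is nonevasive: an
   elementary collapse with pair r < s is undone by adding first s, along the
   subdivision of the cone formed by the proper faces of s other than r, and then
   r, along a cone with apex s.

   If M is nonevasive then sd M is Morse shellable with a single critical tile.
   A facet of sd M is an ordering y_0, ..., y_d of the vertices of a facet of M,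
   its vertices being the sets e_i = {y_0, ..., y_i}.  Order the facets
   lexicographically, each prefix coming with a linear order on its link.  If, after
   y_0, ..., y_(i-1), some vertex precedes y_i, then the maximal face that
   the facet shares with the facets branching off there earlier misses exactly
   e_i, ..., e_(j-1), where y_j is the first later vertex preceding y_i (j = d+1
   if there is none).  If the order on the link of each prefix starts with
   the vertices preceding the last term of the prefix, then a descent occurs at
   j-1, so that e_(j-1) alone is already missing in a shared ridge, unless j = d+1;
   hence every tile is a Morse tile, with Morse face {e_0, ..., e_(i-1)} for the
   last i such that y_i is not the first vertex after its prefix.  It is critical
   only if y_0, ..., y_i are decreasing and no vertex of the link of
   {y_0, ..., y_i} precedes y_i; ordering the lower links by nonevasiveness forbids
   this. *)
Require Import Defs.
From mathcomp Require Import all_boot all_order all_algebra.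
From mathcomp Require Import reals.
From mathcomp Require classical_sets.

Set Implicit Arguments.
Unset Strict Implicit.
Unset Printing Implicit Defensive.

Import GRing.Theory Num.Theory.

(** * Nonevasive flag complexes *)

Definition clique_complex (W : finType) (P : {set W}) (e : rel W) :
    {set {set W}} :=
  [set c : {set W} | (c \subset P) && [forall x in c, forall y in c, e x y]].

Section Nonevasive.
Variables (W : finType) (e : rel W).
Implicit Types Z : {set W}.

(* The set [Z] stands for the complex of its [e]-cliques. *)
Inductive nonevasive : {set W} -> Prop :=
| nonevasive1 x : nonevasive [set x]
| nonevasiveU1 w Z : w \notin Z -> nonevasive Z ->
    nonevasive (Z :&: [set z | e w z]) -> nonevasive (w |: Z).

Lemma nonevasive_neq0 Z : nonevasive Z -> Z != set0.
Proof.
by case=> [x|w Y _ _ _]; apply/set0Pn; [exists x | exists w]; rewrite !inE eqxx.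
Qed.

Hypothesis e_sym : symmetric e.

(** Any vertex other than the apex [a] can be added last: the complex without it is still a cone
    with apex [a], and so is its link. *)
Lemma nonevasive_cone a Z : a \in Z -> (forall z, z \in Z -> e a z) -> nonevasive Z.
Proof.
have [n le_n] := ubnP #|Z|; elim: n Z le_n => // n IHn Z le_n aZ coneZ.
have [Za|/set0Pn[w]] := eqVneq (Z :\ a) set0.
  by rewrite -(setD1K aZ) Za setU0; apply: nonevasive1.
rewrite !inE => /andP[wa wZ]; rewrite -(setD1K wZ).
have lt_n : #|Z :\ w| < n by rewrite (cardsD1 w) wZ in le_n.
have aZw : a \in Z :\ w by rewrite !inE eq_sym wa.
apply: nonevasiveU1; first by rewrite !inE eqxx.
  by apply: IHn => // z /setD1P[_ /coneZ].
apply: IHn; last by move=> z /setIP[/setD1P[_ /coneZ]].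
  by apply: leq_ltn_trans lt_n; apply/subset_leq_card/subsetIl.
by rewrite inE aZw inE e_sym coneZ.
Qed.

(** The list records the order in which the vertices are added; the first one is exempt because its
    lower link is empty. *)
Lemma nonevasive_order Z : nonevasive Z ->
  exists s, [/\ uniq s, [set z in s] = Z & forall y s1 s2, s = s1 ++ y :: s2 ->
    s1 != [::] -> nonevasive ([set z in s1] :&: [set z | e y z])].
Proof.
elim=> [x|w Y wY _ [s [us sY sP]] NE _].
  exists [:: x]; split=> //; first by apply/setP=> z; rewrite !inE.
  by move=> y [|z [|? ?]] s2.
exists (rcons s w); split.
- by rewrite rcons_uniq us andbT -[w \in s](in_set (mem s)) sY.
- by rewrite -sY; apply/setP=> z; rewrite !inE mem_rcons inE.
move=> y s1 s2; case/lastP: s2 => [|s2 z].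
  by rewrite cats1 => /rcons_inj[<- <-]; rewrite sY.
by rewrite -rcons_cons -rcons_cat => /rcons_inj[/sP].
Qed.

End Nonevasive.

(** * From collapses to nonevasive barycentric subdivisions *)

Section BarycentricNonevasive.
Variable V : finType.
Implicit Types (s t r f g : {set V}) (K : {set {set V}}).

Definition nested s t := (s \subset t) || (t \subset s).

Lemma nested_sym : symmetric nested.
Proof. by move=> s t; rewrite /nested orbC. Qed.

Lemma face_closedP K :
  reflect (forall s t, s \in K -> t \subset s -> t \in K) (face_closed K).
Proof.
apply: (iffP forall_inP) => [H s t sK ts|H s sK].
  by apply: (subsetP (H s sK)); rewrite powersetE.
by apply/subsetP=> t; rewrite powersetE; apply: H.
Qed.

Lemma sdE K : sd K = clique_complex (K :\ set0) nested.
Proof.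
apply/setP=> c; rewrite !inE subsetD1 andbA.
by congr (_ && _); apply: eq_forallb => s.
Qed.

(* The simplex [a |: r] without its interior and its face [r] is a cone with
   apex [a]; the faces missing [a] are added by increasing dimension, so that
   [a |: f] is an apex of the lower link of [f]. *)
Lemma nonevasive_horn a r (Y : {set {set V}}) : a \notin r -> r != set0 ->
    (forall f, f \in Y -> (f != set0) && (f \proper r)) ->
  nonevasive nested ([set f : {set V} | (a \in f) && (f \proper a |: r)] :|: Y).
Proof.
move=> ar r0; set B := [set f | _].
have aB : [set a] \in B.
  rewrite inE set11 properEcard subsetUl /= cards1 cardsU1 ar.
  by rewrite -card_gt0 in r0.
have [n le_n] := ubnP #|Y|; elim: n Y le_n => // n IHn Y le_n YP.
have [->|/set0Pn[f0 f0Y]] := eqVneq Y set0.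
  rewrite setU0; apply: (nonevasive_cone nested_sym aB) => f.
  by rewrite inE /nested sub1set => /andP[->].
(* Being largest, [f] is contained in no other member of [Y], so its lower link in [Y] consists of
   subsets of [f]. *)
pose f := [arg max_(f > f0 in Y) #|f|].
have [fY fmax] : f \in Y /\ forall g, g \in Y -> #|g| <= #|f|.
  by rewrite /f; case: arg_maxnP.
have /andP[f0' fr] := YP f fY.
have af : a \notin f by apply: contra ar; apply: (subsetP (proper_sub fr)).
rewrite -(setD1K fY) setUCA.
apply: nonevasiveU1; first by rewrite !inE (negPf af) eqxx.
  apply: IHn; last by move=> g /setD1P[_ /YP].
  by rewrite (cardsD1 f) fY in le_n.
apply: (@nonevasive_cone _ _ nested_sym (a |: f)).
  rewrite !inE eqxx /nested subsetUr andbT /=; apply/orP; left.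
  rewrite properEcard setUS ?proper_sub //= !cardsU1 ar af.
  by rewrite ltn_add2l proper_card.
move=> g; rewrite !inE => /andP[/orP[/andP[ag _]|/andP[gf gY]]] /orP[fg|gf'].
- by rewrite /nested subUset sub1set ag fg.
- by rewrite (subsetP gf' _ ag) in af.
- by case/eqP: gf; apply/eqP; rewrite eq_sym eqEcard fg fmax.
- by rewrite /nested (subset_trans gf') ?subsetUr // orbT.
Qed.

Lemma collapse_nonevasive K K' : set0 \in K' -> face_closed K ->
    elementary_collapse K K' -> nonevasive nested (K' :\ set0) ->
  nonevasive nested (K :\ set0).
Proof.
move=> K'0 /face_closedP Kc /andP[/andP[K'K /face_closedP K'c]].
case/existsP=> s /existsP[r /and4P[/eqP KD _ /andP[rs /eqP card_s] _]] NE.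
have inD x : (x \in K) && (x \notin K') = (x == s) || (x == r).
  by rewrite -in_set2 -KD inE andbC.
have /andP[sK sK'] : (s \in K) && (s \notin K') by rewrite inD eqxx.
have /andP[rK rK'] : (r \in K) && (r \notin K') by rewrite inD eqxx orbT.
have r0 : r != set0 by apply: contraNneq rK' => ->.
have s0 : s != set0 by apply: contraNneq sK' => ->.
have sr : s != r.
  by apply: contra_eq_neq card_s => ->; rewrite neq_ltn ltnSn.
have KE : K :\ set0 = r |: (s |: (K' :\ set0)).
  apply/setP=> x; rewrite !inE.
  have [->|x0] := eqVneq x set0; first by rewrite !(eq_sym set0) (negPf r0) (negPf s0).
  have := inD x; case xK': (x \in K'); first by rewrite (subsetP K'K _ xK') !orbT.
  by rewrite andbT => ->; rewrite !orbF orbC.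
have [a ra sE] : exists2 a, a \notin r & s = a |: r.
  have /set0Pn[a /setDP[sa ra]] : s :\: r != set0.
    by apply: contraNneq sr => /eqP; rewrite setD_eq0 eqEsubset rs andbT.
  exists a => //; apply/eqP; rewrite eq_sym eqEcard subUset sub1set sa rs.
  by rewrite card_s cardsU1 ra /=.
rewrite KE; apply: nonevasiveU1.
- by rewrite !inE eq_sym (negPf sr) (negPf rK') andbF.
-
  apply: nonevasiveU1 => //; first by rewrite !inE (negPf sK') andbF.
  (* The lower link of [s] consists of its nonempty proper faces other than [r]: those containing
     [a], and those properly contained in [r]. *)
  rewrite [X in nonevasive _ X](_ : _ =
     [set f : {set V} | (a \in f) && (f \proper a |: r)] :|:
     [set f : {set V} | (f != set0) && (f \proper r)]).
    by apply: nonevasive_horn => // f; rewrite inE.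
  apply/setP=> f; rewrite !inE -sE /nested.
  have fK' : f \proper s -> (f \in K') = (f != r).
    move=> fs; have := inD f; rewrite (Kc s) ?proper_sub //= (negPf (proper_neq fs)).
    by case: (f \in K') => //= <-.
  case sf: (s \subset f) => /=.
    have f_s : (f \proper s) = false by rewrite properE sf andbF.
    rewrite f_s andbF /=; case: (boolP (f \in K')) => [/K'c/(_ sf)|_].
      by rewrite (negPf sK').
    rewrite andbF; apply/esym/negbTE/negP=> /andP[_ fr].
    by have := sub_proper_trans sf fr; rewrite sE properE subsetUr andbF.
  have [f_s|fNs] /= := boolP (f \subset s); last first.
    have fNs' : (f \proper s) = false by apply: contraNF fNs => /proper_sub.
    rewrite fNs' !andbF; apply/esym/negbTE.
    apply: contra fNs => /andP[_ /proper_sub fr].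
    exact: subset_trans fr rs.
  have fs : f \proper s by rewrite properE f_s sf.
  rewrite fK' // fs !andbT; have [af|af] /= := boolP (a \in f).
    have -> : f != set0 by apply/set0Pn; exists a.
    by apply: contraNneq ra => <-.
  rewrite properEneq; congr (_ && _); rewrite -[LHS]andbT; congr (_ && _).
  apply/esym/subsetP=> x xf; have := subsetP f_s x xf.
  by rewrite sE !inE; case: eqP xf af => // -> ->.
(* No simplex of [K'] contains [r], so apart from [s] the lower link of [r] consists of faces of
   [r], all contained in [s]. *)
apply: (@nonevasive_cone _ _ nested_sym s).
  by rewrite !inE eqxx /nested rs.
move=> z; rewrite !inE => /andP[/orP[/eqP->|/andP[_ zK']]].
  by rewrite /nested subxx.
case/orP=> [/(K'c z r zK')|zr]; first by rewrite (negPf rK').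
by rewrite /nested (subset_trans zr rs) orbT.
Qed.

Lemma collapsible_nonevasive K : face_closed K -> collapsible K ->
  nonevasive nested (K :\ set0).
Proof.
move=> Kc /existsP[v /connectP[l]].
elim: l K Kc => [K _ _ /= <-|K' l IHl K Kc /= /andP[KK' K'l] lastE].
  rewrite (_ : _ :\ _ = [set [set v]]); first exact: nonevasive1.
  apply/setP=> s; rewrite !inE subset1; have [->|_] := eqVneq s set0.
    by rewrite eq_sym -cards_eq0 cards1.
  by rewrite orbF.
have K'c : face_closed K' by case/andP: KK' => /andP[].
apply: collapse_nonevasive KK' (IHl _ K'c K'l lastE) => //.
(* The complexes of a collapse sequence are nested, so each contains the empty face of the final
   vertex. *)
have : set0 \in powerset [set v] by rewrite powersetE sub0set.
rewrite lastE; move: K'l; elim: l {IHl lastE K'c} K' => //= L l IHl K'.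
case/andP=> /andP[/andP[/subsetP LK' _] _] Ll lE; exact: LK' (IHl _ Ll lE).
Qed.

End BarycentricNonevasive.

(* [D] consists of the vertices opposite to the missing ridges and [F :\: G] is
   the Morse face, or a further missing ridge if [G] is a singleton; it is redundant
   if [G] meets [D].  Since [D] is the restriction set of the basic tile, the strict
   inclusion rules out critical tiles. *)
Definition regular_tile (U : finType) (F : {set U}) (T : {set {set U}}) :=
  [exists D : {set U}, exists G : {set U},
    [&& D :|: G \proper F, G != set0
      & T == [set t in powerset F | (D \subset t) && (t :&: G != set0)]]].

(** A shelling step whose new tile is regular; [connect] chains such steps. *)
Definition grow (U : finType) (S Y Y' : {set {set U}}) :=
  [exists F, [&& facet S F, Y' == Y :|: powerset F
               & regular_tile F (powerset F :\: Y)]].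

(** * Flags and the missing faces of their tiles *)

Section Flags.
Variables (W : finType) (M : {set {set W}}).
Hypothesis M_closed : face_closed M.
Implicit Types (x y z : W) (f g : {set W}) (p t D H : {set {set W}}).
Implicit Types Y : {set {set {set W}}}.
Implicit Types S Z : {set W}.

Lemma in_sdP t :
  reflect [/\ forall f, f \in t -> f \in M, set0 \notin t
            & forall f g, f \in t -> g \in t -> (f \subset g) || (g \subset f)]
          (t \in sd M).
Proof.
rewrite inE; apply: (iffP and3P) => [[/subsetP ? ? H]|[? ? H]]; split=> //.
- by move=> f g ft; apply: (forall_inP (forall_inP H f ft)).
- exact/subsetP.
- by apply/forall_inP=> f ft; apply/forall_inP=> g; apply: H.
Qed.

Lemma sd_subset (s t : {set {set W}}) : t \in sd M -> s \subset t -> s \in sd M.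
Proof.
case/in_sdP=> tM t0 tch /subsetP st; apply/in_sdP; split.
- by move=> f /st/tM.
- by apply: contra t0 => /st.
- by move=> f g /st ft /st gt; apply: tch.
Qed.

Lemma sd_min (t t' : {set {set W}}) : t \in sd M -> t' \subset t -> t' != set0 ->
  exists2 f, f \in t' & forall g, g \in t' -> f \subset g.
Proof.
move=> /in_sdP[_ _ tch] /subsetP t't /set0Pn[f0 f0t].
case: (arg_minnP (fun f : {set W} => #|f|) f0t) => f ft fmin; exists f => // g gt.
case/orP: (tch f g (t't f ft) (t't g gt)) => // gf.
by have /eqP-> : g == f by rewrite eqEcard gf fmin.
Qed.

(** The members of a flag have distinct cardinals, here all between 1 and [#|g|]. *)
Lemma sd_card t g : t \in sd M -> (forall f, f \in t -> f \subset g) ->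
  #|t| <= #|g|.
Proof.
move=> /in_sdP[_ t0 tch] tg.
rewrite -(size_iota 1 #|g|) cardE -(size_map (fun f : {set W} => #|f|)).
apply: uniq_leq_size.
  rewrite map_inj_in_uniq ?enum_uniq // => f h; rewrite !mem_enum => ft ht /= fh.
  by apply/eqP; case/orP: (tch f h ft ht) => H; last rewrite eq_sym;
    rewrite eqEcard H fh leqnn.
move=> _ /mapP[f + ->]; rewrite mem_enum mem_iota add1n ltnS => ft.
rewrite subset_leq_card ?tg // andbT card_gt0.
by apply: contraNneq t0 => <-.
Qed.

Definition link g := [set y | (y \notin g) && (y |: g \in M)].

(* [p] lists the first terms [set y_0], [set y_0; y_1], ... of a maximal flag of
   [M], up to its last term [g] (or [p] and [g] are empty). *)
Definition full_flag p g :=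
  [/\ p \in sd M, g \in M, forall f, f \in p -> f \subset g, #|p| = #|g|
    & g != set0 -> g \in p].

(* The union of the facets of [sd M] which extend [p], together with their
   faces. *)
Definition block p g :=
  [set t in sd M | [forall f in t, (f \in p) || (g \subset f)]].

Definition star p g y := block ((y |: g) |: p) (y |: g).

Definition stars p g S := \bigcup_(y in S) star p g y.

(** The terms of a flag increase, so those lying here form a run that stops at the first term after
    [g] meeting [Z]. *)
Definition avoiding g Z :=
  [set f : {set W} | (g \proper f) && [disjoint f & Z]].

Lemma blockE p g t : (t \in block p g) =
  (t \in sd M) && [forall f in t, (f \in p) || (g \subset f)].
Proof. by rewrite inE. Qed.

Lemma full_flag0 : set0 \in M -> full_flag set0 set0.
Proof.
move=> M0; split; rewrite ?cards0 ?eqxx //; last by move=> f; rewrite inE.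
by apply/in_sdP; split=> [f||f g]; rewrite inE.
Qed.

Section Star.
Variables (p : {set {set W}}) (g : {set W}).
Hypothesis pg : full_flag p g.

Lemma full_flagN y : y \in link g -> y |: g \notin p.
Proof.
case: pg => _ _ p_g _ _; rewrite inE => /andP[yg _]; apply: contra yg => /p_g.
by rewrite subUset sub1set => /andP[].
Qed.

Lemma full_flag_ext y : y \in link g -> full_flag ((y |: g) |: p) (y |: g).
Proof.
move=> yl; have ygp := full_flagN yl.
case: pg yl => /in_sdP[pM p0 pch] gM p_g card_p _; rewrite inE => /andP[yg ygM].
have p_yg f : f \in p -> f \subset y |: g.
  by move=> /p_g fg; rewrite (subset_trans fg) ?subsetUr.
split=> //; last by rewrite setU11.
- apply/in_sdP; split=> [f||f h]; rewrite ?inE.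
  + by case/predU1P=> [->|/pM].
  + by rewrite negb_or p0 andbT; apply/eqP=> /setP/(_ y); rewrite !inE eqxx.
  + by case/predU1P=> [->|fp] /predU1P[->|hp]; rewrite ?subxx ?p_yg ?orbT ?pch.
- by move=> f /setU1P[->|/p_yg].
- by rewrite !cardsU1 ygp yg card_p.
Qed.

Lemma starE y t : (t \in star p g y) =
  (t \in sd M) && [forall f in t, (f \in p) || (y |: g \subset f)].
Proof.
rewrite blockE; congr (_ && _); apply: eq_forallb => f; congr (_ ==> _).
by rewrite in_setU1; case: eqP => //= ->; rewrite subxx orbT.
Qed.

Lemma star_block y t : t \in star p g y -> t \in block p g.
Proof.
rewrite starE blockE => /andP[-> /forall_inP ty] /=; apply/forall_inP=> f /ty.
by case/orP=> [->//|]; rewrite subUset => /andP[_ ->]; rewrite orbT.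
Qed.

(** All terms of a flag outside [p] contain the least such term [f], which strictly contains [g];
    any [y] in [f :\: g] then gives a star containing the flag. *)
Lemma block_cover : link g != set0 -> block p g = stars p g (link g).
Proof.
move=> /set0Pn[y0 y0l]; apply/eqP; rewrite eqEsubset; apply/andP; split; last first.
  by apply/bigcupsP=> y _; apply/subsetP=> t /star_block.
apply/subsetP=> t; rewrite blockE => /andP[tM /forall_inP tpg].
have [t0|tn0] := eqVneq (t :\: p) set0.
  apply/bigcupP; exists y0 => //; rewrite starE tM; apply/forall_inP=> f ft.
  by move/eqP: t0; rewrite setD_eq0 => /subsetP->.
have [f] := sd_min tM (subsetDl _ _) tn0.
rewrite inE => /andP[fp ft] fmin.
have gf : g \proper f.
  have := tpg f ft; rewrite (negPf fp) /= properEneq => ->; rewrite andbT.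
  apply: contraNneq fp => fE; rewrite -fE; case: pg => _ _ _ _; apply.
  by rewrite fE; apply: contraTneq tM => f0; apply/in_sdP => -[_]; rewrite -f0 ft.
case/properP: gf => gf [y yf yg].
have ygf : y |: g \subset f by rewrite subUset sub1set yf.
case/in_sdP: (tM) => t_M _ _.
apply/bigcupP; exists y.
  by rewrite inE yg; apply: (elimT (face_closedP _) M_closed _ _ (t_M f ft)).
rewrite starE tM; apply/forall_inP=> h ht.
have [//|hp] := boolP (h \in p).
by rewrite (subset_trans ygf) ?orbT // fmin // inE hp ht.
Qed.

(** An empty link makes [g] a facet of [M], so no term can follow [g], and [sd_card] bounds by
    [#|g|] the length of a flag containing [p]. *)
Lemma block_facet : link g = set0 -> block p g = powerset p /\ facet (sd M) p.
Proof.
case: (pg) => pM gM p_g card_p gp l0.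
have top f : f \in M -> g \subset f -> f = g.
  move=> fM gf; apply/eqP; rewrite eqEsubset gf andbT; apply/subsetP=> y yf.
  apply: contraT => yg; have : y \in link g; last by rewrite l0 inE.
  rewrite inE yg; apply: (elimT (face_closedP _) M_closed _ _ fM).
  by rewrite subUset sub1set yf.
have inp t f : t \in sd M -> f \in t -> g \subset f -> f \in p.
  case/in_sdP=> tM t0 _ ft /(top _ (tM f ft)) fE.
  by rewrite fE gp // -fE; apply: contraNneq t0 => <-.
split.
  apply/setP=> t; rewrite blockE powersetE.
  apply/andP/idP=> [[tM /forall_inP tp]|tp].
    apply/subsetP=> f ft; case/orP: (tp f ft) => //; exact: inp tM ft.
  split; first exact: sd_subset pM tp.
  by apply/forall_inP=> f /(subsetP tp)->.
apply/maxsetP; split=> // q qM pq; apply/eqP; rewrite eq_sym eqEcard pq card_p.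
apply: sd_card (qM) _ => f fq; have [g0|/gp/(subsetP pq) gq] := eqVneq g set0.
  case/in_sdP: (qM) => q_M _ _.
  by rewrite (top f) ?q_M // g0 sub0set.
case/in_sdP: (qM) => q_M _ qch; case/orP: (qch f g fq gq) => // /(top f (q_M f fq)) ->.
exact: subxx.
Qed.

(** A flag lies in the star of [z] when its terms outside [p] all contain [z] and [g]. The least of
    these terms decides: it has to meet [S], which [y |: g] does not. *)
Lemma starsE S y t : S \subset link g -> S != set0 ->
    y \in link g -> y \notin S -> t \in star p g y ->
  (t \in stars p g S) = (t :&: ([set y |: g] :|: avoiding (y |: g) S) == set0).
Proof.
move=> /subsetP Sl Sn0 yl yS; rewrite starE => /andP[tM /forall_inP ty].
have Sg z : z \in S -> z \notin g by move=> /Sl; rewrite inE => /andP[].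
have Sy z : z \in S -> z \notin y |: g.
  by move=> zS; rewrite !inE negb_or Sg // andbT; apply: contraNneq yS => <-.
have pN f : f \in p -> y |: g \subset f -> False.
  case: pg => _ _ p_g _ _ /p_g fg ygf; have := subset_trans ygf fg.
  rewrite subUset sub1set; case/andP=> yg _; move: yl.
  by rewrite inE yg.
apply/bigcupP/eqP => [[z zS]|t0].
  rewrite starE tM => /forall_inP tz; apply/setP=> f; rewrite !inE.
  apply/negbTE/andP=> -[ft fP].
  have ygf : y |: g \subset f.
    by case/orP: fP => [/eqP->//|/andP[/proper_sub->]].
  have zf : z \in f.
    case/orP: (tz f ft) => [/pN//|]; by rewrite subUset sub1set => /andP[].
  case/orP: fP => [/eqP fE|/andP[_ dis]]; first by have := Sy z zS; rewrite -fE zf.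
  by rewrite (disjointFr dis zf) in zS.
have [tp|tn0] := eqVneq (t :\: p) set0.
  case/set0Pn: Sn0 => z zS; exists z => //; rewrite starE tM.
  by apply/forall_inP=> f ft; move/eqP: tp; rewrite setD_eq0 => /subsetP->.
have [f] := sd_min tM (subsetDl _ _) tn0; rewrite inE => /andP[fp ft] fmin.
have ygf : y |: g \subset f by case/orP: (ty f ft) => // fp'; rewrite fp' in fp.
have /negbT : f \in t :&: ([set y |: g] :|: avoiding (y |: g) S) = false.
  by rewrite t0 inE.
rewrite !inE ft negb_or properEneq ygf andbT eq_sym => /andP[-> /=].
rewrite -setI_eq0 => /set0Pn[z /setIP[zf zS]]; exists z => //.
rewrite starE tM; apply/forall_inP=> h ht; have [//|hp /=] := boolP (h \in p).
have fh : f \subset h by apply: fmin; rewrite inE hp.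
rewrite subUset sub1set (subsetP fh z zf) (subset_trans _ fh) //.
by rewrite (subset_trans _ ygf) ?subsetUr.
Qed.
End Star.


(* The vertices in [D] are opposite to ridges which are missing in all the facets
   extending [p].  The second condition is a missing face which is not determined
   yet: its complement consists of [H] and of the terms of the flag after [g], up to
   the first one which meets [Z]. *)
Definition status Y p g D H Z := forall t, t \in block p g ->
  (t \notin Y) = (D \subset t) && (t :&: (H :|: avoiding g Z) != set0).

Lemma star_proper p g y t f : full_flag p g -> t \in star p g y -> f \in t ->
  g \proper f -> y |: g \subset f.
Proof.
case=> _ _ p_g _ _; rewrite starE => /andP[_ /forall_inP ty] ft gf.
case/orP: (ty f ft) => // /p_g fg.
by have := proper_sub_trans gf fg; rewrite properxx.
Qed.

Lemma stars0 p g : stars p g set0 = set0.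
Proof. by rewrite /stars big_set0. Qed.

Lemma status_first p g y S : full_flag p g -> y \in link g ->
    S \subset link g -> y \notin S -> S != set0 ->
  status (stars p g S) ((y |: g) |: p) (y |: g) set0 [set y |: g] S.
Proof. by move=> pg yl Sl yS S0 t ty; rewrite sub0set (starsE pg Sl S0 yl yS ty). Qed.

(** The next term [y |: g] meets [Z], so the pending run is [g] alone and [g] joins [D]. The earlier
    siblings [S] of [y] start a new run; if there are none, [g |: D] fills the second condition,
    which it makes redundant. *)
Lemma status_in Y p g D Z y S : full_flag p g -> y \in link g ->
    S \subset link g -> y \notin S -> status Y p g D [set g] Z -> y \in Z ->
  status (Y :|: stars p g S) ((y |: g) |: p) (y |: g) (g |: D)
    (if S == set0 then g |: D else [set y |: g]) S.
Proof.
move=> pg yl Sl yS st yZ t ty; rewrite inE negb_or st ?(star_block ty) //.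
have -> : (t :&: ([set g] :|: avoiding g Z) != set0) = (g \in t).
  apply/set0Pn/idP=> [[f]|gt]; last by exists g; rewrite !inE gt eqxx.
  rewrite !inE => /andP[ft /predU1P[<-//|/andP[gf dis]]].
  have := star_proper pg ty ft gf; rewrite subUset sub1set => /andP[yf _].
  by rewrite (disjointFr dis yf) in yZ.
rewrite subUset sub1set [(g \in t) && _]andbC -!andbA; congr (_ && _).
case: (boolP (g \in t)) => //= gt.
have [->|S0] := eqVneq S set0; last by rewrite (starsE pg Sl S0 yl yS ty).
rewrite stars0 inE; apply/esym/set0Pn; exists g.
by rewrite !inE eqxx gt.
Qed.

(** All vertices of [Z] in the link lie in [S], so a term avoiding [S] avoids [Z]: the condition
    coming from [S] implies the pending one and replaces it. If [S] is empty, no later term can meet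
    [Z] and the run goes on to the end. *)
Lemma status_out Y p g D H Z y S : full_flag p g -> y \in link g ->
    S \subset link g -> y \notin S -> [disjoint g & Z] -> Z :&: link g \subset S ->
    status Y p g D H Z -> y \notin Z ->
  status (Y :|: stars p g S) ((y |: g) |: p) (y |: g) D
    (if S == set0 then (y |: g) |: H else [set y |: g]) S.
Proof.
move=> pg yl Sl yS gZ ZS st yZ t ty; rewrite inE negb_or st ?(star_block ty) //.
rewrite -andbA; congr (_ && _).
have [tM tP] : t \in sd M /\ forall f, f \in t -> (f \in p) || (y |: g \subset f).
  by move: (ty); rewrite starE => /andP[? /forall_inP].
have linkf f : f \in t -> g \subset f -> f :\: g \subset link g.
  case/in_sdP: tM => tM _ _ ft gf; apply/subsetP=> z /setDP[zf zg]; rewrite inE zg.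
  apply: (elimT (face_closedP _) M_closed _ _ (tM f ft)).
  by rewrite subUset sub1set zf.
have avoidZ f : f \in t -> g \proper f -> [disjoint f & S] -> [disjoint f & Z].
  move=> ft gf; rewrite -!setI_eq0 -!subset0 => fS; apply/subsetP=> z /setIP[zf zZ].
  apply: (subsetP fS); rewrite inE zf; apply: (subsetP ZS); rewrite inE zZ.
  apply: (subsetP (linkf f ft (proper_sub gf))); rewrite inE zf andbT.
  by apply: contraTN zZ => zg; rewrite (disjointFr gZ zg).
have g_yg : g \proper y |: g.
  rewrite properE subsetUr /= subUset sub1set negb_and.
  by move: yl; rewrite inE => /andP[->].
have ygS : [disjoint y |: g & S].
  rewrite -setI_eq0 -subset0; apply/subsetP=> z /setIP[/setU1P[->|zg] zS].
    by rewrite zS in yS.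
  by have := subsetP Sl z zS; rewrite inE zg.
have [S0|S0] := eqVneq S set0; last first.
  rewrite (starsE pg Sl S0 yl yS ty) andbC; case: set0Pn => //= -[f].
  rewrite !inE => /andP[ft fP]; apply/set0Pn; exists f; rewrite !inE ft /=.
  case/predU1P: fP => [fE|/andP[gf dis]].
    by rewrite fE g_yg avoidZ ?orbT // -?fE ?ft // fE.
  have gf' : g \proper f by apply: proper_trans g_yg gf.
  by rewrite gf' avoidZ ?orbT.
rewrite S0 stars0 inE andbT.
congr (_ != _); apply/setP=> f; rewrite !inE; case ft: (f \in t) => //=.
have -> : [disjoint f & (set0 : {set W})] by rewrite -setI_eq0 setI0.
rewrite andbT orbAC orbC; congr (_ || _).
have -> : (f == y |: g) || (y |: g \proper f) = (y |: g \subset f).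
  rewrite properEneq eq_sym; case: eqP => //= ->; exact: esym (subxx _).
apply/andP/idP=> [[gf _]|ygf]; first exact: (star_proper pg ty ft gf).
have gf : g \proper f by apply: proper_sub_trans ygf.
by rewrite gf avoidZ // S0 -setI_eq0 setI0.
Qed.

(** * Growing blocks star by star along ordered links *)

Lemma explore p g s0 s Y :
  (forall s1 y s2, s = s1 ++ y :: s2 ->
     let Y1 := Y :|: stars p g [set z in s0 ++ s1] in
     connect (grow (sd M)) Y1 (Y1 :|: star p g y)) ->
  connect (grow (sd M)) (Y :|: stars p g [set z in s0])
                        (Y :|: stars p g [set z in s0 ++ s]).
Proof.
elim/last_ind: s => [|s y IHs] sP; first by rewrite cats0 connect0.
apply: (@connect_trans _ _ (Y :|: stars p g [set z in s0 ++ s])).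
  by apply: IHs => s1 z s2 sE; apply: (sP _ _ (rcons s2 y)); rewrite sE rcons_cat.
have := sP s y [::]; rewrite cats1 => /(_ erefl) /=.
rewrite -setUA; congr (connect _ _ (_ :|: _)).
rewrite /stars -rcons_cat; set X := [set z in _].
rewrite (_ : [set z in rcons _ _] = X :|: [set y]) ?bigcup_setU ?big_set1 //.
by apply/setP=> z; rewrite !inE mem_rcons inE orbC.
Qed.


Lemma stars1 p g y : stars p g [set z in [:: y]] = star p g y.
Proof.
rewrite /stars (_ : [set z in _] = [set y]) ?big_set1 //.
by apply/setP=> z; rewrite !inE.
Qed.

Lemma explore_from p g y0 s :
  (forall s1 y s2, y0 :: s = (y0 :: s1) ++ y :: s2 ->
     let Y1 := stars p g [set z in y0 :: s1] in
     connect (grow (sd M)) Y1 (Y1 :|: star p g y)) ->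
  connect (grow (sd M)) (stars p g [set z in [:: y0]])
                        (stars p g [set z in y0 :: s]).
Proof.
move=> sP; have := @explore p g [:: y0] s set0; rewrite /= !set0U; apply.
by move=> s1 y s2 sE; rewrite !set0U; apply: sP; rewrite sE.
Qed.

Definition link_order g Z (sZ : seq W) := sZ ++ enum (link g :\: Z).

Lemma mem_link_order g Z sZ : [set z in sZ] = Z :&: link g ->
  [set z in link_order g Z sZ] = link g.
Proof.
move=> sZE; apply/setP=> z; rewrite inE mem_cat mem_enum.
rewrite -[z \in sZ](in_set (mem sZ)) sZE in_setI in_setD.
by case: (z \in Z) => //=; rewrite orbF.
Qed.

(** Since [sZ] comes first, a vertex of [Z] is preceded by an initial part of [sZ] only, as
    [status_in] is used, and any other vertex by all of [sZ], as [status_out] requires. *)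
Lemma link_order_split g Z sZ s1 y s2 (S := [set z in s1]) :
    uniq sZ -> [set z in sZ] = Z :&: link g ->
    link_order g Z sZ = s1 ++ y :: s2 ->
  [/\ y \in link g, S \subset link g, y \notin S,
      y \in Z -> exists s3, sZ = s1 ++ y :: s3
    & y \notin Z -> Z :&: link g \subset S].
Proof.
move=> us sZE sE; have inlink z : z \in link_order g Z sZ -> z \in link g.
  by rewrite -[in X in _ -> X](mem_link_order sZE) inE.
have mZ z : (z \in sZ) = (z \in Z) && (z \in link g).
  by rewrite -in_setI -sZE inE.
have uL : uniq (link_order g Z sZ).
  rewrite cat_uniq us enum_uniq andbT; apply/hasPn=> z.
  by rewrite mem_enum !inE /= mZ => /andP[/negPf->].
have ys1 : y \notin s1.
  by move: uL; rewrite sE cat_uniq /= negb_or => /and3P[_ /andP[]].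
have yl : y \in link g by apply: inlink; rewrite sE mem_cat inE eqxx orbT.
split=> //.
- by apply/subsetP=> z; rewrite inE => zs; apply: inlink; rewrite sE mem_cat zs.
- by rewrite inE.
- move=> yZ; have ysZ : y \in sZ by rewrite mZ yZ yl.
  have s1E : s1 = take (index y sZ) sZ.
    have := congr1 (index y) sE; rewrite !index_cat ysZ (negPf ys1) index_head addn0.
    move=> iE; have : take (index y sZ) (link_order g Z sZ) = s1.
      by rewrite sE take_size_cat.
    by rewrite /link_order take_cat index_mem ysZ.
  exists (drop (index y sZ).+1 sZ); rewrite s1E -{1}(cat_take_drop (index y sZ) sZ).
  by congr (_ ++ _); rewrite (drop_nth y) ?index_mem // nth_index.
move=> yZ; apply/subsetP=> z; rewrite inE -mZ => zs; rewrite inE.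
(* Once the order has left [Z], it does not return to it. *)
have : pairwise (fun a b => (b \in Z) ==> (a \in Z)) (link_order g Z sZ).
  rewrite pairwise_cat; apply/and3P; split.
  - by apply/allrelP=> a b; rewrite mZ => /andP[-> _] _; rewrite implybT.
  - apply/(pairwiseP y)=> i j ilt _ _.
    by have := mem_nth y ilt; rewrite mZ => /andP[-> _]; rewrite implybT.
  apply/(pairwiseP y)=> i j /= _ jlt _; apply/implyP.
  by have := mem_nth y jlt; rewrite mem_enum inE => /andP[/negPf->].
rewrite sE pairwise_cat /= => /and4P[_ _ /allP yb _].
have : z \in link_order g Z sZ by rewrite mem_cat zs.
have zZ : z \in Z by move: zs; rewrite mZ => /andP[].
rewrite sE mem_cat inE => /or3P[//|/eqP zy|/yb]; first by rewrite -zy zZ in yZ.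
by rewrite zZ (negPf yZ).
Qed.

Lemma link_decr g y : y \in link g -> #|~: (y |: g)| < #|~: g|.
Proof.
rewrite inE => /andP[yg _]; apply: proper_card; rewrite properC.
by rewrite properE subsetUr subUset sub1set (negPf yg).
Qed.

Lemma disjoint_link g y S : y \in link g -> S \subset link g -> y \notin S ->
  [disjoint y |: g & S].
Proof.
move=> yl /subsetP Sl yS; rewrite disjoint_sym -setI_eq0 -subset0.
apply/subsetP=> z /setIP[zS /setU1P[zy|zg]]; first by rewrite -zy zS in yS.
by have := Sl z zS; rewrite inE zg.
Qed.

(* A term of [p] outside [D :|: H] stays outside when the flag is extended, hence
   all tiles are regular; the links can be ordered arbitrarily, with [Z] first. *)
Lemma connect_safe p g D H Z Y : full_flag p g -> D :|: H \proper p ->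
    H != set0 -> [disjoint g & Z] -> (Z = set0 \/ H = [set g]) ->
    status Y p g D H Z ->
  connect (grow (sd M)) Y (Y :|: block p g).
Proof.
have [n le_n] := ubnP #|~: g|; elim: n p g D H Z Y le_n => // n IHn.
move=> p g D H Z Y le_n pg DHp H0 gZ ZH st.
have [l0|l0] := eqVneq (link g) set0.
  (* At a facet no term after [g] remains, so [H] alone is the complement of the missing face. *)
  have [bE pF] := block_facet pg l0; rewrite bE; apply: connect1.
  apply/existsP; exists p; rewrite pF eqxx /=; apply/existsP; exists D.
  apply/existsP; exists H; rewrite DHp H0 /=; apply/eqP/setP=> t.
  rewrite !inE andbC; case tp: (t \subset p) => //=.
  rewrite st ?bE ?powersetE //; congr (_ && (_ != _)).
  apply/setP=> f; rewrite !inE; case ft: (f \in t) => //=.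
  case: pg => _ _ p_g _ _; rewrite properE p_g ?andbF ?orbF //.
  exact: (subsetP tp).
(* The term [q] stays outside: [g] joins [D] only when [H] is [[set g]], so that [q] is not [g], and
   the only other new term is [y |: g], not in [p]. *)
have [q qp qDH] : exists2 q, q \in p & q \notin D :|: H.
  by case/properP: DHp.
have DHp' := proper_sub DHp; move: DHp'; rewrite subUset => /andP[Dp Hp].
have sZE : [set z in enum (Z :&: link g)] = Z :&: link g.
  by apply/setP=> z; rewrite inE mem_enum.
rewrite (block_cover pg l0) -(mem_link_order sZE) -[X in connect _ X _]setU0.
rewrite -(stars0 p g) (_ : set0 = [set z in [::]]).
  2: by apply/setP=> z; rewrite !inE.
apply: (@explore p g [::]) => s1 y s2 sE; rewrite cat0s.
have [yl Sl yS _ yNZ] := link_order_split (enum_uniq _) sZE sE.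
set S := [set z in s1] in Sl yS yNZ *; cbv zeta.
have ygp := full_flagN pg yl.
have qyg : q != y |: g by apply: contraNneq ygp => <-.
move: qDH; rewrite inE negb_or => /andP[qD qH].
have safe D' H' : D' \subset (y |: g) |: p -> H' \subset (y |: g) |: p ->
    q \notin D' -> q \notin H' -> D' :|: H' \proper (y |: g) |: p.
  move=> D'p H'p qD' qH'; apply/properP; rewrite subUset D'p H'p; split=> //.
  by exists q; rewrite !inE ?qp ?orbT // negb_or qD'.
have pp : p \subset (y |: g) |: p by apply: subsetUr.
have yp : [set y |: g] \subset (y |: g) |: p by rewrite sub1set setU11.
have lt_n : #|~: (y |: g)| < n by apply: leq_trans (link_decr yl) _.
have [yZ|yZ] := boolP (y \in Z).
  case: ZH => [Z0|HE]; first by rewrite Z0 inE in yZ.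
  rewrite HE in st H0 Hp qH.
  have gDp : g |: D \subset p by rewrite subUset Hp.
  have qgD : q \notin g |: D by rewrite inE negb_or qD qH.
  apply: (IHn _ _ _ _ _ _ lt_n (full_flag_ext pg yl) _ _ _ _
    (status_in pg yl Sl yS st yZ)).
  - by case: ifP => _; rewrite safe ?(subset_trans gDp) // inE.
  - by case: ifP => _; apply/set0Pn; [exists g | exists (y |: g)]; rewrite !inE eqxx.
  - exact: disjoint_link.
  - by case: eqP; [left | right].
apply: (IHn _ _ _ _ _ _ lt_n (full_flag_ext pg yl) _ _ _ _
  (status_out pg yl Sl yS gZ (yNZ yZ) st yZ)).
- case: ifP => _; rewrite safe ?(subset_trans Dp) ?inE //.
    by rewrite subUset sub1set setU11 (subset_trans Hp).
  by rewrite negb_or qyg.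
- by case: ifP => _; apply/set0Pn; exists (y |: g); rewrite !inE eqxx.
- exact: disjoint_link.
- by case: eqP; [left | right].
Qed.

(** The first branches lead down to one facet, the closed simplex. On every later branch only the
    earlier siblings cause a missing face, so [D] is empty, [H] is the new term, and the nonempty
    [p] makes [connect_safe] applicable. *)
Lemma connect_first p g : full_flag p g -> p != set0 ->
  exists2 F, facet (sd M) F & connect (grow (sd M)) (powerset F) (block p g).
Proof.
have [n le_n] := ubnP #|~: g|; elim: n p g le_n => // n IHn p g le_n pg p0.
have [l0|l0] := eqVneq (link g) set0.
  by have [bE pF] := block_facet pg l0; exists p; rewrite // bE connect0.
have sZE : [set z in [::]] = set0 :&: link g.
  by rewrite set0I; apply/setP=> z; rewrite !inE.
rewrite (block_cover pg l0); have sE := mem_link_order sZE.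
case sL: (link_order g set0 [::]) sE => [|y0 s] sE.
  by case/eqP: l0; rewrite -sE; apply/setP=> z; rewrite !inE.
have y0l : y0 \in link g by rewrite -sE inE mem_head.
have [F FF cF] : exists2 F, facet (sd M) F
    & connect (grow (sd M)) (powerset F) (star p g y0).
  apply: (IHn _ _ _ (full_flag_ext pg y0l)).
    exact: leq_trans (link_decr y0l) _.
  by apply/set0Pn; exists (y0 |: g); rewrite setU11.
exists F => //; apply: connect_trans cF _; rewrite -sE -{1}(stars1 p g y0).
apply: explore_from => s1 y s2 sE1; rewrite sE1 in sL.
have [yl Sl yS _ yNZ] := link_order_split (sZ := [::]) isT sZE sL.
have S0 : [set z in y0 :: s1] != set0 by apply/set0Pn; exists y0; rewrite inE mem_head.
have st := status_first pg yl Sl yS S0.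
apply: connect_safe (full_flag_ext pg yl) _ _ (disjoint_link yl Sl yS) _ st.
- rewrite set0U properEcard sub1set setU11 cards1 cardsU1 (full_flagN pg yl).
  by rewrite add1n ltnS card_gt0.
- by apply/set0Pn; exists (y |: g); rewrite inE.
- by right.
Qed.

(** * Excluding further critical tiles by nonevasive lower links *)

Section NonevasiveLinks.
Variable e : rel W.
Hypothesis M_flag : forall g y z, y \in link g -> z \in link g -> z != y ->
  (z \in link (y |: g)) = e y z.

(** This turns the lower link of [y] in a nonevasive order into the set of earlier vertices
    available after the prefix [y |: g]. *)
Lemma link_adj g y S : y \in link g -> S \subset link g -> y \notin S ->
  S :&: link (y |: g) = S :&: [set z | e y z].
Proof.
move=> yl /subsetP Sl yS; apply/setP=> z; rewrite !in_setI [in RHS]in_set.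
have [zS|//] := boolP (z \in S); apply: M_flag => //; first exact: Sl.
by apply: contraNneq yS => <-.
Qed.

(* Here [D :|: H] is all of [p], so that a tile would be critical if the link of [g]
   contained no vertex of [Z]. *)
Lemma connect_nonevasive p g Z Y : full_flag p g -> g \in p -> [disjoint g & Z] ->
    nonevasive e (Z :&: link g) -> status Y p g (p :\ g) [set g] Z ->
  connect (grow (sd M)) Y (Y :|: block p g).
Proof.
have [n le_n] := ubnP #|~: g|; elim: n p g Z Y le_n => // n IHn.
move=> p g Z Y le_n pg gp gZ NE st.
(* A nonevasive set is nonempty, so the unsafe case never reaches a facet. *)
have Z0 := nonevasive_neq0 NE.
have l0 : link g != set0 by apply: contraNneq Z0 => ->; rewrite setI0.
have [sZ [uZ sZE sZ_NE]] := nonevasive_order NE.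
rewrite (block_cover pg l0) -(mem_link_order sZE) -[X in connect _ X _]setU0.
rewrite -(stars0 p g) (_ : set0 = [set z in [::]]).
  2: by apply/setP=> z; rewrite !inE.
apply: (@explore p g [::]) => s1 y s2 sE; rewrite cat0s.
have [yl Sl yS yZP yNZ] := link_order_split uZ sZE sE; cbv zeta.
have ygp := full_flagN pg yl.
have lt_n : #|~: (y |: g)| < n by apply: leq_trans (link_decr yl) _.
have pf := full_flag_ext pg yl; have dis := disjoint_link yl Sl yS.
have [yZ|yZ] := boolP (y \in Z).
  have := status_in pg yl Sl yS st yZ; rewrite (setD1K gp).
  (* If [y] comes first, [D] and [H] both become [p], and the new term [y |: g] outside them makes
     the branch safe. *)
  have [S0|S0] := eqVneq [set z in s1] set0.
    move=> st'; apply: connect_safe pf _ _ dis _ st'; last by left.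
      rewrite setUid; apply/properP; split; first exact: subsetUr.
      by exists (y |: g); rewrite ?setU11.
    by apply/set0Pn; exists g.
  (* Otherwise the terms still decrease and [D :|: H] fills the flag again; the new set [Z] is the
     lower part of a nonevasive order. *)
  move=> st'; apply: IHn pf _ dis _ _ => //; first exact: setU11.
    rewrite (link_adj yl Sl yS); have [s3 /sZ_NE] := yZP yZ; apply.
    by apply: contraNneq S0 => ->; apply/eqP/setP=> z; rewrite !inE.
  by rewrite setU1K.
(* Here [y] comes after the nonempty [Z :&: link g], so [H] is reset to [[set y |: g]] and [g] is
   left outside [D :|: H]. *)
have S0 : [set z in s1] != set0.
  have /set0Pn[z zZ] := Z0; apply/set0Pn; exists z.
  exact: (subsetP (yNZ yZ)).
have := status_out pg yl Sl yS gZ (yNZ yZ) st yZ; rewrite (negPf S0) => st'.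
have g_yg : g != y |: g by apply: contraNneq ygp => <-.
apply: connect_safe pf _ _ dis _ st'; last by right.
  apply/properP; split; last first.
    by exists g; rewrite !inE ?gp ?orbT // eqxx (negPf g_yg).
  rewrite subUset sub1set setU11 andbT.
  exact: subset_trans (subD1set _ _) (subsetUr _ _).
by apply/set0Pn; exists (y |: g); rewrite inE.
Qed.

Lemma block0 : block set0 set0 = sd M.
Proof.
apply/setP=> t; rewrite blockE; case: (t \in sd M) => //=.
by apply/forall_inP=> f _; rewrite sub0set orbT.
Qed.

(** The star of the first vertex starts from a closed simplex. Each later star starts with a flag of
    one term, already all of [H], so the nonevasive order is needed from the outset. *)
Lemma connect_sd : set0 \in M -> nonevasive e (link set0) ->
  exists2 F, facet (sd M) F & connect (grow (sd M)) (powerset F) (sd M).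
Proof.
move=> M0 NE; have pg := full_flag0 M0.
have l0 := nonevasive_neq0 NE.
have [sZ [uZ sZE' sZ_NE]] := nonevasive_order NE.
(* Taking [Z] to be the whole link makes [link_order] the nonevasive order itself. *)
have sZE : [set z in sZ] = link set0 :&: link set0 by rewrite setIid.
rewrite -{3}block0 (block_cover pg l0); have sE := mem_link_order sZE.
have LE : link_order set0 (link set0) sZ = sZ.
  by rewrite /link_order setDv enum_set0 cats0.
case sL: (link_order set0 (link set0) sZ) sE => [|y0 s] sE.
  by case/eqP: l0; rewrite -sE; apply/setP=> z; rewrite !inE.
have y0l : y0 \in link set0 by rewrite -sE inE mem_head.
have [F FF cF] : exists2 F, facet (sd M) F
    & connect (grow (sd M)) (powerset F) (star set0 set0 y0).
  apply: (connect_first (full_flag_ext pg y0l)).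
  by apply/set0Pn; exists (y0 |: set0); rewrite setU11.
exists F => //; apply: connect_trans cF _; rewrite -sE -{1}(stars1 set0 set0 y0).
apply: explore_from => s1 y s2 sE1; rewrite sE1 in sL.
have [yl Sl yS _ _] := link_order_split uZ sZE sL.
have S0 : [set z in y0 :: s1] != set0 by apply/set0Pn; exists y0; rewrite inE mem_head.
have st := status_first pg yl Sl yS S0; cbv zeta.
apply: (connect_nonevasive (full_flag_ext pg yl) _ (disjoint_link yl Sl yS)).
- exact: setU11.
- by rewrite (link_adj yl Sl yS); apply: (sZ_NE y _ s2) => //; rewrite -LE sL.
- by rewrite setU0 setU0 setDv in st *.
Qed.

End NonevasiveLinks.
End Flags.

Lemma clique_complex_closed (W : finType) (P : {set W}) (e : rel W) :
  face_closed (clique_complex P e).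
Proof.
apply/face_closedP=> s t; rewrite !inE => /andP[sP /forall_inP se] ts.
rewrite (subset_trans ts sP); apply/forall_inP=> x xt.
apply/forall_inP=> y yt.
by move/forall_inP: (se x (subsetP ts x xt)); apply; apply: (subsetP ts).
Qed.

Lemma connect_sd_clique (W : finType) (P : {set W}) (e : rel W)
    (M := clique_complex P e) :
  symmetric e -> reflexive e -> nonevasive e P ->
  exists2 F, facet (sd M) F & connect (grow (sd M)) (powerset F) (sd M).
Proof.
move=> e_sym e_refl NE.
have in_link g y : g \in M -> (y \in link M g) =
    [&& y \notin g, y \in P & [forall x in g, e y x]].
  rewrite !inE => /andP[gP /forall_inP ge]; congr (_ && _).
  rewrite subUset sub1set gP andbT; congr (_ && _).
  apply/forall_inP/forall_inP=> [H x xg|H x].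
    by move/forall_inP: (H y (setU11 _ _)); apply; apply: setU1r.
  case/setU1P=> [->|xg]; apply/forall_inP=> z /setU1P[->|zg] //; first exact: H.
    by rewrite e_sym H.
  exact: (forall_inP (ge x xg)).
have M0 : set0 \in M.
  by rewrite inE sub0set; apply/forall_inP=> x; rewrite inE.
apply: (@connect_sd _ _ (clique_complex_closed P e) e) => //.
  move=> g y z yl zl zy.
  have ygM : y |: g \in M by move: yl; rewrite inE => /andP[].
  have gM : g \in M.
    exact: (elimT (face_closedP _) (clique_complex_closed P e) _ _ ygM (subsetUr _ _)).
  move: zl; rewrite !in_link // => /and3P[zg zP /forall_inP ze].
  rewrite !inE negb_or zy zg zP /= e_sym.
  apply/forall_inP/idP=> [H|ezy x /setU1P[->//|]]; last exact: ze.
  by apply: H; apply: setU11.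
rewrite (_ : link M set0 = P) //; apply/setP=> y; rewrite in_link // inE /=.
by rewrite andb_idr // => _; apply/forall_inP=> x; rewrite inE.
Qed.

(** * Regular tiles are Morse tiles and are not critical *)

Section Tiles.
Variable U : finType.
Implicit Types (s D G t r : {set U}) (T : {set {set U}}).

Definition opposite_ridges s D := [set s :\ v | v in D].

Lemma missing_opposite_ridges s D : s != set0 -> D \subset s ->
  missing_ridges #|s|.-1 #|opposite_ridges s D| s (opposite_ridges s D).
Proof.
move=> s0 /subsetP Ds; rewrite /missing_ridges prednK ?card_gt0 // !eqxx /=.
apply/forall_inP=> _ /imsetP[v vD ->].
by rewrite /ridge subD1set (cardsD1 v s) (Ds v vD) /=.
Qed.

Lemma not_in_opposite_ridges s D t : t \subset s ->
  [forall r in opposite_ridges s D, ~~ (t \subset r)] = (D \subset t).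
Proof.
move=> ts; apply/forall_inP/subsetP=> [H v vD|Dt _ /imsetP[v vD ->]].
  have := H _ (imset_f _ vD); apply: contraR => vt.
  apply/subsetP=> x xt; rewrite !inE (subsetP ts) // andbT.
  by apply: contraNneq vt => <-.
by apply/negP=> /subsetP/(_ v (Dt v vD)); rewrite !inE eqxx.
Qed.

(** The missing ridges are those opposite to the restriction set [r]; avoiding them means containing
    [r], and removing [r] makes the inclusion strict. *)
Lemma critical_tileE n s (F : {set {set U}}) k : missing_ridges n k s F ->
  #|restriction_set s F| = k /\ deprive s (restriction_set s F |: F) =
    [set t in powerset s | restriction_set s F \proper t].
Proof.
case/and3P=> /eqP card_s /eqP card_F /forall_inP Fs; set r := restriction_set s F.
have FE : F = opposite_ridges s r.
  apply/setP=> f; apply/idP/imsetP=> [fF|[v]]; last by rewrite inE => /andP[_ ?] ->.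
  have /andP[fs /eqP card_sf] := Fs f fF.
  have /cards1P[v vE] : #|s :\: f| == 1.
    by rewrite cardsD (setIidPr fs) card_sf subSnn.
  have fE : f = s :\ v by rewrite -vE setDDr setDv set0U (setIidPr fs).
  have : v \in s :\: f by rewrite vE set11.
  by exists v => //; rewrite !inE -fE fF; case/setDP: H => ->.
have rs : r \subset s by apply/subsetP=> v; rewrite inE => /andP[].
split.
  rewrite -card_F FE card_in_imset // => x y xr yr /setP/(_ x).
  rewrite !inE eqxx /= (subsetP rs) // andbT.
  by case: eqP.
apply/setP=> t; rewrite !inE; case ts: (t \subset s) => //=.
rewrite properE -(not_in_opposite_ridges r ts) -FE.
apply/forall_inP/andP=> [H|[/forall_inP H1 H2] f /setU1P[->//|]]; last exact: H1.
split; last by apply: H; apply: setU11.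
by apply/forall_inP=> f fF; apply: H; apply: setU1r.
Qed.

Section Regular.
Variables (s : {set U}) (T : {set {set U}}).
Hypothesis T_reg : regular_tile s T.

Lemma regular_tile_top : s \in T.
Proof.
case/existsP: T_reg => D /existsP[G /and3P[DGs G0 /eqP->]].
have := proper_sub DGs; rewrite subUset => /andP[Ds Gs].
by rewrite !inE subxx Ds (setIidPr Gs).
Qed.

Lemma regular_tile_set0 : set0 \notin T.
Proof.
case/existsP: T_reg => D /existsP[G /and3P[_ _ /eqP->]].
by rewrite !inE set0I eqxx !andbF.
Qed.

Lemma regular_tile_neq0 : s != set0.
Proof. by apply: contraTneq regular_tile_top => ->; apply: regular_tile_set0. Qed.

Lemma regular_tile_morse : exists n k, morse_tile n k T.
Proof.
have s0 := regular_tile_neq0.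
case/existsP: T_reg => D /existsP[G /and3P[DGs G0 /eqP->]].
have := proper_sub DGs; rewrite subUset => /andP[Ds Gs].
exists #|s|.-1.
have [DG|DG] := boolP [disjoint D & G]; last first.
  exists #|opposite_ridges s D|; left; exists s, (opposite_ridges s D).
  split; first exact: missing_opposite_ridges.
  apply/setP=> t; rewrite !inE; case ts: (t \subset s) => //=.
  rewrite not_in_opposite_ridges //; case Dt: (D \subset t) => //=.
  move: DG; rewrite -setI_eq0 => /set0Pn[x /setIP[xD xG]]; apply/set0Pn; exists x.
  by rewrite inE xG (subsetP Dt).
have [/cards1P[v GE]|G1] := boolP (#|G| == 1).
  exists #|opposite_ridges s (D :|: G)|; left; exists s, (opposite_ridges s (D :|: G)).
  split; first by apply: missing_opposite_ridges; rewrite // subUset Ds.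
  apply/setP=> t; rewrite !inE; case ts: (t \subset s) => //=.
  rewrite not_in_opposite_ridges // subUset; congr (_ && _); rewrite GE sub1set.
  apply/set0Pn/idP=> [[x]|vt]; first by rewrite !inE => /andP[xt /eqP<-].
  by exists v; rewrite !inE vt eqxx.
(* Meeting [G] means not lying in [s :\: G], whose codimension [#|G|] is at least 2 here. *)
exists #|opposite_ridges s D|; right; exists s, (opposite_ridges s D), (s :\: G).
split; first exact: missing_opposite_ridges.
- exact: subsetDl.
- rewrite cardsD (setIidPr Gs) -(subnK (subset_leq_card Gs)) addnK leq_add2l.
  by rewrite ltn_neqAle eq_sym G1 card_gt0.
apply/setP=> t; rewrite !inE; case ts: (t \subset s) => //=.
rewrite -(not_in_opposite_ridges D ts).
have tG : (t :&: G != set0) = ~~ (t \subset s :\: G).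
  by rewrite subsetD ts /= -setI_eq0.
rewrite tG; apply/andP/forall_inP=> [[/forall_inP H1 H2] f /setU1P[->//|]|H].
  exact: H1.
split; last by apply: H; apply: setU11.
by apply/forall_inP=> f fD; apply: H; apply: setU1r.
Qed.

(** Adding or removing a vertex [q] of [s] outside [D :|: G] preserves membership in the tile. So
    [s :\ q] is in it, whence [q \notin r]; then [q |: r] is in it, and [r] would be too. *)
Lemma regular_tile_not_critical n k : ~ critical_tile n k T.
Proof.
case=> [[_ [s' _ TE]]|[le_kn [s' [F [miss TE]]]]].
  by have := regular_tile_set0; rewrite TE powersetE sub0set.
have [card_r] := critical_tileE miss; rewrite -TE; set r := restriction_set s' F.
have /eqP card_s' : #|s'| == n.+1 by case/and3P: miss.
have rs' : r \subset s' by apply/subsetP=> v; rewrite inE => /andP[].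
case/existsP: T_reg => D /existsP[G /and3P[DGs G0 /eqP TE']].
rewrite {1}TE' => /setP TEr.
have inT t : [&& t \subset s, D \subset t & t :&: G != set0] =
    (t \subset s') && (r \proper t).
  by have := TEr t; rewrite !inE.
have [Ds Gs] : D \subset s /\ G \subset s.
  by apply/andP; rewrite -subUset proper_sub.
(* Both are the top face of the tile; [k <= n] ensures that [s'] strictly contains [r]. *)
have ss' : s = s'.
  apply/eqP; rewrite eqEsubset; apply/andP; split.
    by have := inT s; rewrite subxx Ds (setIidPr Gs) G0 => /esym/andP[].
  have := inT s'; rewrite subxx properEcard rs' card_s'.
  by rewrite [#|r|]card_r ltnS le_kn => /and3P[].
case/properP: DGs => _ [q qs]; rewrite inE negb_or => /andP[qD qG].
have qr : q \notin r.
  have := inT (s :\ q); rewrite -ss' subD1set subsetD1 Ds qD /=.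
  have -> : (s :\ q) :&: G != set0.
    by rewrite setIDAC (setIidPr Gs) (setDidPl _) // disjoint_sym disjoints1.
  by move=> /esym/proper_sub; rewrite subsetD1 => /andP[].
rewrite -ss' in rs'; have := inT (q |: r); rewrite -ss' subUset sub1set qs rs' /=.
rewrite properEcard subsetUr cardsU1 qr add1n ltnS leqnn /= => /andP[Dqr Gqr].
have := inT r; rewrite properxx andbF rs' /= => /negbT/negP; apply.
apply/andP; split.
  apply/subsetP=> v vD; have := subsetP Dqr v vD; rewrite !inE; case/predU1P=> // vq.
  by rewrite -vq vD in qD.
case/set0Pn: Gqr => v /setIP[/setU1P[->|vr] vG]; first by rewrite vG in qG.
by apply/set0Pn; exists v; rewrite inE vr.
Qed.
End Regular.
End Tiles.

(** * From growth sequences to Morse shellings *)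

(** The barycentre of [s] is a witness; a partition must have nonempty parts. *)
Lemma realization_inhabited (R : realType) (U : finType) (A : {set {set U}}) s :
  s \in A -> s != set0 -> classical_sets.nonempty (realization (R := R) A).
Proof.
move=> sA s0; have cs : (#|s|%:R != 0 :> R)%R by rewrite pnatr_eq0 cards_eq0.
exists (fun v => if v \in s then #|s|%:R^-1 else 0)%R; split.
- by move=> v; case: ifP => // _; rewrite invr_ge0 ler0n.
- by rewrite -big_mkcond sumr_const -[LHS]mulr_natl mulfV.
rewrite (_ : [set v | _] = s) //; apply/setP=> v; rewrite inE.
by case: ifP => _; rewrite ?eqxx // invr_eq0 cs.
Qed.

Lemma grow_shelling (R : realType) (U : finType) (X : {set {set U}}) F0 :
    simplicial_complex X -> facet X F0 -> F0 != set0 ->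
    connect (grow X) (powerset F0) X ->
  exists (tiles : {set {set {set U}}}) (N : nat) (S : nat -> {set {set U}}),
    morse_shelling R X set0 tiles N S /\
    exists C, [/\ C \in tiles, exists n, closed_simplex n C
                & forall T, T \in tiles ->
                    ((exists n k, critical_tile n k T) <-> T = C)].
Proof.
move=> Xs FF0 F00 /connectP[l /(pathP set0) lP lE].
have /andP[_ /face_closedP Xc] := Xs.
(* The filtration starts one step before the path, with the empty complex, so that tile 0 is the
   closed simplex on [F0], the only critical one. *)
pose S := nth set0 (set0 :: powerset F0 :: l); pose N := (size l).+1.
pose tile i := S i.+1 :\: S i.
have SP i : i < N -> exists F, [/\ facet X F, F != set0, S i.+1 = S i :|: powerset F,
    F \notin S i & if i is 0 then F = F0 else regular_tile F (tile i)].
  case: i => [_|i]; first by exists F0; split; rewrite ?set0U ?inE.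
  rewrite ltnS => /lP/existsP[F /and3P[FF /eqP SE reg]]; exists F.
  have tE : tile i.+1 = powerset F :\: S i.+1.
    by rewrite /tile /S /= SE setDUl setDv set0U.
  rewrite tE; split => //; first exact: regular_tile_neq0 reg.
  by have := regular_tile_top reg; case/setDP.
have facetX F : facet X F -> F \in X by case/maxsetP.
have Sc i : i <= N -> subcomplex (S i) X.
  elim: i => [_|i IHi lt_i].
    by rewrite /subcomplex sub0set; apply/face_closedP=> s t; rewrite inE.
  have [F [FF _ -> _ _]] := SP i lt_i.
  have /andP[SX /face_closedP Sc] := IHi (ltnW lt_i).
  apply/andP; split.
    rewrite subUset SX; apply/subsetP=> s; rewrite powersetE; apply: Xc; exact: facetX.
  apply/face_closedP=> s t /setUP[/Sc St /St|]; first by rewrite inE => ->.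
  by rewrite !inE => sF ts; rewrite (subset_trans ts) ?orbT.
have Smono i j : i <= j -> j <= N -> S i \subset S j.
  elim: j => [|j IHj]; first by rewrite leqn0 => /eqP->.
  rewrite leq_eqVlt => /predU1P[->//|]; rewrite ltnS => ij lt_j.
  apply: subset_trans (IHj ij (ltnW lt_j)) _; have [F [_ _ -> _ _]] := SP j lt_j.
  exact: subsetUl.
have SN : S N = X by rewrite lE /S /N [RHS](last_nth set0).
pose tiles := [set tile i | i : 'I_N].
have tilesP T : T \in tiles -> exists2 i, i < N & T = tile i.
  by case/imsetP=> i _ ->; exists i.
have tileT i : i < N -> tile i \in tiles.
  by move=> lt_i; apply/imsetP; exists (Ordinal lt_i).
have tile_lt i j s : i < j -> j < N -> s \in tile i -> s \in tile j -> False.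
  move=> ij jN /setDP[si _] /setDP[_ /negP]; apply.
  exact: (subsetP (Smono _ _ ij (ltnW jN))).
have tile_cover s : s \in X -> exists2 i, i < N & s \in tile i.
  rewrite -SN; move: (leqnn N); move: {1 3}N; elim=> [|n IHn] le_n.
    by rewrite inE.
  have [sn _|sn sn1] := boolP (s \in S n); first exact: IHn (ltnW le_n) sn.
  by exists n; rewrite // inE sn.
have tileE i F : S i.+1 = S i :|: powerset F -> tile i = powerset F :\: S i.
  by rewrite /tile => ->; rewrite setDUl setDv set0U.
have tile0 : tile 0 = powerset F0 by rewrite /tile /S /= setD0.
exists tiles, N, S; split; last first.
  exists (powerset F0); split; first by rewrite -tile0 tileT.
    by exists #|F0|.-1; exists F0; rewrite // prednK ?card_gt0.
  move=> T /tilesP[[|i] lt_i ->].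
    rewrite tile0; split=> // _; exists #|F0|.-1, 0; left; split=> //.
    by exists F0; rewrite // prednK ?card_gt0.
  have [F [_ _ _ _ reg]] := SP _ lt_i.
  split=> [[n [k /(regular_tile_not_critical reg)]]|tE] //.
  by have := regular_tile_set0 reg; rewrite tE powersetE sub0set.
split; last first.
- move=> T /tilesP[[|i] lt_i ->].
    exists #|F0|.-1, 0; left; exists F0, set0; split.
      rewrite /missing_ridges prednK ?card_gt0 // cards0 !eqxx.
      by apply/forall_inP=> r; rewrite inE.
    rewrite tile0; apply/setP=> t; rewrite !inE [X in _ && X](_ : _ = true) ?andbT //.
    by apply/forall_inP=> r; rewrite inE.
  by have [F [_ _ _ _ reg]] := SP _ lt_i; apply: regular_tile_morse reg.
- split=> //; first by rewrite SN setD0.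
    by move=> p /Sc Sp; exists (S p); rewrite // setD0.
  by move=> p lt_p; split; [exact: Smono | exact: tileT].
split.
- apply/and3P; split=> //; first exact: Sc 0 _.
  by apply/forall_inP=> s _; rewrite inE.
- move=> T /tilesP[i lt_i ->]; have [F [FF _ SE FS _]] := SP i lt_i.
  have /andP[SX /face_closedP Sci] := Sc _ (ltnW lt_i).
  exists F, (powerset F :&: S i); split=> //.
  + rewrite /subcomplex subsetIl; apply/face_closedP=> s t.
    rewrite !inE => /andP[sF sS] ts; rewrite (subset_trans ts sF) /=; exact: Sci sS ts.
  + by rewrite inE powersetE subxx.
  + by rewrite setI0 sub0set.
  + by rewrite (tileE _ _ SE) setDIr setDv set0U.
split.
- apply/classical_sets.seteqP; split=> x.
    case=> T /tilesP[i lt_i ->] [x0 x1 xT]; split=> //; rewrite setD0 -SN.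
    by apply: (subsetP (Smono i.+1 N lt_i (leqnn _))); case/setDP: xT.
  case=> x0 x1; rewrite setD0 => /tile_cover[i lt_i xi].
  by exists (tile i); [exact: tileT | split].
- move=> T T' /tilesP[i lt_i ->] /tilesP[j lt_j ->] [x [[_ _ xi] [_ _ xj]]].
  have [ij|ij|->//] := ltngtP i j; first by case: (tile_lt i j _ ij lt_j xi xj).
  by case: (tile_lt j i _ ij lt_i xj xi).
move=> T /tilesP[i lt_i ->]; have [F [_ F_n0 SE FS _]] := SP i lt_i.
apply: (realization_inhabited R (s := F)) => //.
by rewrite (tileE _ _ SE) inE FS powersetE subxx.
Qed.

(** * The second barycentric subdivision of a collapsible complex *)

Lemma simplicial_complex_sd (V : finType) (K : {set {set V}}) :
  simplicial_complex (sd K).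
Proof.
rewrite sdE; apply/andP; split; last exact: clique_complex_closed.
by rewrite inE sub0set; apply/forall_inP=> s; rewrite inE.
Qed.

Lemma sd_vertex (V : finType) (K : {set {set V}}) s :
  s \in K -> s != set0 -> [set s] \in sd K.
Proof.
move=> sK s0; rewrite !inE sub1set sK eq_sym s0 /=.
by apply/forall_inP=> x /set1P->; apply/forall_inP=> y /set1P->; rewrite subxx.
Qed.

Theorem corollary1p3 (R : realType) (V : finType) (K : {set {set V}}) :
  simplicial_complex K -> collapsible K ->
  exists (tiles : {set {set {set {set {set V}}}}}) (N : nat)
         (S : nat -> {set {set {set {set V}}}}),
    morse_shelling R (sd (sd K)) set0 tiles N S /\
    exists C, [/\ C \in tiles, exists n, closed_simplex n C
                & forall T, T \in tiles ->
                    ((exists n k, critical_tile n k T) <-> T = C)].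
Proof.
move=> /andP[_ Kc] Kcol; have NE := collapsible_nonevasive Kc Kcol.
have comp_refl : reflexive (@nested V) by move=> s; rewrite /nested subxx.
have [F] := connect_sd_clique (@nested_sym V) comp_refl NE; rewrite -sdE => FF.
apply: (grow_shelling R (simplicial_complex_sd _) FF).
have /set0Pn[s sK] := nonevasive_neq0 NE.
(* The empty face is not a facet, as a simplex [s] of [K] gives a vertex of the second
   subdivision. *)
apply: contraTneq FF => ->; apply/negP=> /maxsetP[_ F0].
move: sK; rewrite !inE => /andP[s0 sK].
have : [set [set s]] \in sd (sd K).
  by rewrite !sd_vertex // -cards_eq0 cards1.
by move=> /F0/(_ (sub0set _))/eqP; rewrite -cards_eq0 cards1.
Qed.
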